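(* Let $\mathbf A=\mathrm{diag}(a_1,a_2,a_3)$ be a nonsingular diagonal matrix and let $\mathbf A^\vee=\mathbf A^{-1}\cdot\det\mathbf A$ be its cofactor matrix. On the level set $(\gamma,\gamma)=1$, $(\gamma,M)=0$ of $\mathbb R^6\ni(\gamma,M)$, $\gamma,M\in\mathbb R^3$, the functions $$\hat H=\alpha\,(M,\mathbf AM)-\Bigl((\gamma,\mathbf A^\vee\gamma)-\alpha(\gamma,\mathbf A\gamma)+\alpha\,\mathrm{tr}\,\mathbf A\Bigr)(M,M),$$ where $$\alpha=(\gamma,\mathbf A^\vee\gamma)\,\mathrm{tr}\,\mathbf A^{-1}+2(\gamma,\mathbf A\gamma)-2\,\mathrm{tr}\,\mathbf A,$$ and $$\hat K=\Bigl((\gamma,\mathbf A^\vee\gamma)(\gamma,\mathbf AM)-\bigl((\gamma,\mathbf A\gamma)-\mathrm{tr}\,\mathbf A\bigr)(\gamma,\mathbf A^\vee M)\Bigr)^2\Bigl((M,\mathbf AM)+\bigl((\gamma,\mathbf A\gamma)-\mathrm{tr}\,\mathbf A\bigr)(M,M)\Bigr)$$ are in involution, $\{\hat H,\hat K\}=0$, with respect to the Poisson bracket $$\{M_i,M_j\}=\varepsilon_{ijk}M_k,\qquad \{M_i,\gamma_j\}=\varepsilon_{ijk}\gamma_k,\qquad \{\gamma_i,\gamma_j\}=0 .$$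
   Context: $(\cdot,\cdot)$ is the Euclidean scalar product on $\mathbb R^3$, $\varepsilon_{ijk}$ is the totally skew-symmetric tensor (summation over $k$). The functions $(\gamma,\gamma)$ and $(\gamma,M)$ are Casimir functions of this Lie–Poisson bracket of $e^*(3)$, so the bracket restricts to the level set $(\gamma,\gamma)=1$, $(\gamma,M)=0$, which is identified with $T^*\mathbb S^2$. *)

(* Defs.v *)
From HB Require Import structures.
From mathcomp Require Import all_boot all_order all_algebra.
From mathcomp Require Import all_classical all_reals all_analysis.
From mathcomp Require Import ring.

Set Implicit Arguments.
Unset Strict Implicit.
Unset Printing Implicit Defensive.

Import Order.TTheory GRing.Theory Num.Theory.
Import numFieldNormedType.Exports.

Local Open Scope ring_scope.

Definition dot (R : realType) (u v : 'cV[R]_3) : R :=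
  \sum_(i < 3) u i 0 * v i 0.

(* Meaningful for nonsingular A only: invmx A is A when A is singular. *)
Definition cofactor_mx (R : realType) (A : 'M[R]_3) : 'M[R]_3 :=
  \det A *: invmx A.

Definition levi_civita (R : realType) (i j k : 'I_3) : R :=
  if (val i, val j, val k) \in [:: (0, 1, 2); (1, 2, 0); (2, 0, 1)]%N then 1
  else if (val i, val j, val k) \in [:: (0, 2, 1); (2, 1, 0); (1, 0, 2)]%N
  then -1 else 0.

(* Points of R^6 are pairs x = (gamma, M): x.1 is gamma and x.2 is M. *)
Definition d_gamma (R : realType) (i : 'I_3)
    (f : 'cV[R]_3 * 'cV[R]_3 -> R) (x : 'cV[R]_3 * 'cV[R]_3) : R :=
  'D_(delta_mx i 0, 0) f x.

Definition d_M (R : realType) (i : 'I_3)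
    (f : 'cV[R]_3 * 'cV[R]_3 -> R) (x : 'cV[R]_3 * 'cV[R]_3) : R :=
  'D_(0, delta_mx i 0) f x.

(* The biderivation determined by the brackets of the coordinate functions,
   {f, g} = sum over pairs of coordinates u, v of (df/du) (dg/dv) {u, v};
   here {gamma_i, M_j} = - {M_j, gamma_i} = eps_ijk gamma_k. *)
Definition poisson (R : realType)
    (f g : 'cV[R]_3 * 'cV[R]_3 -> R) (x : 'cV[R]_3 * 'cV[R]_3) : R :=
  \sum_(i < 3) \sum_(j < 3) \sum_(k < 3) levi_civita R i j k *
    (x.2 k 0 * (d_M i f x * d_M j g x)
     + x.1 k 0 * (d_M i f x * d_gamma j g x + d_gamma i f x * d_M j g x)).

Definition hat_alpha (R : realType) (A : 'M[R]_3) (x : 'cV[R]_3 * 'cV[R]_3) : R :=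
  let g := x.1 in
  dot g (cofactor_mx A *m g) * \tr (invmx A) + 2 * dot g (A *m g) - 2 * \tr A.

Definition hatH (R : realType) (A : 'M[R]_3) (x : 'cV[R]_3 * 'cV[R]_3) : R :=
  let g := x.1 in let m := x.2 in let alpha := hat_alpha A x in
  alpha * dot m (A *m m)
  - (dot g (cofactor_mx A *m g) - alpha * dot g (A *m g) + alpha * \tr A)
    * dot m m.

Definition hatK (R : realType) (A : 'M[R]_3) (x : 'cV[R]_3 * 'cV[R]_3) : R :=
  let g := x.1 in let m := x.2 in
  (dot g (cofactor_mx A *m g) * dot g (A *m m)
   - (dot g (A *m g) - \tr A) * dot g (cofactor_mx A *m m)) ^+ 2
  * (dot m (A *m m) + (dot g (A *m g) - \tr A) * dot m m).

Section LiePoisson.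
Variable R : realType.
Implicit Types (f : 'cV[R]_3 * 'cV[R]_3 -> R) (x v : 'cV[R]_3 * 'cV[R]_3).

Lemma is_derive_line f x v (df : R) :
  is_derive (0 : R) 1 (fun h : R => f (h *: v + x)) df -> is_derive x v f df.
Proof.
move=> [H1 H2].
have E : (fun h : R => h^-1 *: (((fun h : R => f (h *: v + x)) \o shift 0)
      (h *: (1 : R)) - f (0 *: v + x)))
    = (fun h : R => h^-1 *: ((f \o shift x) (h *: v) - f x)).
  by apply/funext => h /=; rewrite addr0 scale0r add0r [h *: 1]mulr1.
split; first by rewrite /derivable -E.
by rewrite /derive -E.
Qed.

Lemma is_derive_affine (c d : R) :
  is_derive (0 : R) 1 (fun h : R => h * c + d) c.
Proof.
rewrite (_ : (fun _ => _) = horner (c *: 'X + d%:P)).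
  by apply: is_derive_eq; rewrite derivD derivZ derivX derivC addr0 hornerZ hornerC mulr1.
by apply/funext => h; rewrite !hornerE mulrC.
Qed.

Lemma is_derive_gamma (i : 'I_3) x v :
  is_derive x v (fun y => y.1 i 0) (v.1 i 0).
Proof.
apply: is_derive_line.
rewrite (_ : (fun _ => _) = (fun h : R => h * v.1 i 0 + x.1 i 0)).
  exact: is_derive_affine.
by apply/funext => h; rewrite !mxE.
Qed.

Lemma is_derive_M (i : 'I_3) x v :
  is_derive x v (fun y => y.2 i 0) (v.2 i 0).
Proof.
apply: is_derive_line.
rewrite (_ : (fun _ => _) = (fun h : R => h * v.2 i 0 + x.2 i 0)).
  exact: is_derive_affine.
by apply/funext => h; rewrite !mxE.
Qed.

Lemma d_gamma_gamma (i j : 'I_3) x :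
  d_gamma i (fun y => y.1 j 0) x = (i == j)%:R :> R.
Proof.
rewrite /d_gamma (@derive_val _ _ _ _ _ _ _ (is_derive_gamma _ _ _)) /=.
by rewrite !mxE eqxx andbT eq_sym.
Qed.

Lemma d_gamma_M (i j : 'I_3) x : d_gamma i (fun y => y.2 j 0) x = 0 :> R.
Proof.
rewrite /d_gamma (@derive_val _ _ _ _ _ _ _ (is_derive_M _ _ _)) /=.
by rewrite !mxE.
Qed.

Lemma d_M_gamma (i j : 'I_3) x : d_M i (fun y => y.1 j 0) x = 0 :> R.
Proof.
rewrite /d_M (@derive_val _ _ _ _ _ _ _ (is_derive_gamma _ _ _)) /=.
by rewrite !mxE.
Qed.

Lemma d_M_M (i j : 'I_3) x :
  d_M i (fun y => y.2 j 0) x = (i == j)%:R :> R.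
Proof.
rewrite /d_M (@derive_val _ _ _ _ _ _ _ (is_derive_M _ _ _)) /=.
by rewrite !mxE eqxx andbT eq_sym.
Qed.

Lemma sum_delta (i j : 'I_3) (F : 'I_3 -> 'I_3 -> R) :
  \sum_(a < 3) \sum_(b < 3) (a == i)%:R * (b == j)%:R * F a b = F i j.
Proof.
rewrite (bigD1 i) //= [X in _ + X]big1 ?addr0; last first.
  by move=> a /negPf ->; rewrite big1 // => b _; rewrite !mul0r.
rewrite (bigD1 j) //= [X in _ + X]big1 ?addr0 ?eqxx ?mul1r //.
by move=> b /negPf ->; rewrite mulr0 mul0r.
Qed.

(* The bracket has the prescribed values on the coordinate functions. *)
Lemma poisson_MM (i j : 'I_3) x :
  poisson (fun y => y.2 i 0) (fun y => y.2 j 0) x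
  = \sum_(k < 3) levi_civita R i j k * x.2 k 0.
Proof.
rewrite -[RHS](sum_delta i j (fun a b => \sum_k levi_civita R a b k * x.2 k 0)).
apply: eq_bigr => a _; apply: eq_bigr => b _; rewrite mulr_sumr.
apply: eq_bigr => k _; rewrite !d_M_M !d_gamma_M; ring.
Qed.

Lemma poisson_Mgamma (i j : 'I_3) x :
  poisson (fun y => y.2 i 0) (fun y => y.1 j 0) x
  = \sum_(k < 3) levi_civita R i j k * x.1 k 0.
Proof.
rewrite -[RHS](sum_delta i j (fun a b => \sum_k levi_civita R a b k * x.1 k 0)).
apply: eq_bigr => a _; apply: eq_bigr => b _; rewrite mulr_sumr.
apply: eq_bigr => k _.
rewrite !d_M_M !d_gamma_M !d_M_gamma !d_gamma_gamma; ring.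
Qed.

Lemma poisson_gammagamma (i j : 'I_3) x :
  poisson (fun y => y.1 i 0) (fun y => y.1 j 0) x = 0 :> R.
Proof.
rewrite /poisson big1 // => a _; rewrite big1 // => b _; rewrite big1 // => k _.
rewrite !d_M_gamma !d_gamma_gamma; ring.
Qed.

Lemma sum_levi_civita (F : 'I_3 -> 'I_3 -> 'I_3 -> R) :
  let i0 : 'I_3 := ord0 in let i1 := lift ord0 ord0 in
  let i2 := lift ord0 (lift ord0 ord0) in
  \sum_(i < 3) \sum_(j < 3) \sum_(k < 3) levi_civita R i j k * F i j k
  = F i0 i1 i2 - F i0 i2 i1 + F i1 i2 i0 - F i1 i0 i2 + F i2 i0 i1 - F i2 i1 i0.
Proof.
rewrite /= !big_ord_recl !big_ord0 /levi_civita /=.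
by rewrite !(mul0r, mul1r, mulN1r, addr0, add0r); ring.
Qed.

Lemma is_derive_dot_gamma x v :
  is_derive x v (fun y => dot y.1 y.1) (2 * dot x.1 v.1).
Proof.
have := is_derive_sum (fun i => is_deriveM (is_derive_gamma i x v)
  (is_derive_gamma i x v)).
set f := (\sum_(_ < _) _); rewrite (_ : f = (fun y => dot y.1 y.1)).
  move=> H; apply: (is_derive_eq H); rewrite /dot mulr_sumr; apply: eq_bigr => i _.
  by rewrite /GRing.scale /=; ring.
by apply/funext => y; rewrite /f fct_sumE.
Qed.

Lemma is_derive_dot_gammaM x v :
  is_derive x v (fun y => dot y.1 y.2) (dot x.1 v.2 + dot x.2 v.1).
Proof.
have := is_derive_sum (fun i => is_deriveM (is_derive_gamma i x v)
  (is_derive_M i x v)).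
set f := (\sum_(_ < _) _); rewrite (_ : f = (fun y => dot y.1 y.2)).
  move=> H; apply: (is_derive_eq H); rewrite /dot -big_split; apply: eq_bigr => i _.
  by rewrite /GRing.scale /=; ring.
by apply/funext => y; rewrite /f fct_sumE.
Qed.

Lemma dot0r (u : 'cV[R]_3) : dot u 0 = 0.
Proof. by rewrite /dot big1 // => i _; rewrite mxE mulr0. Qed.

Lemma dot_delta (u : 'cV[R]_3) (i : 'I_3) : dot u (delta_mx i 0) = u i 0.
Proof.
rewrite /dot (bigD1 i) //= big1 ?addr0 ?mxE ?eqxx ?mulr1 //.
by move=> j /negPf nij; rewrite mxE nij mulr0.
Qed.

(* (gamma, gamma) and (gamma, M) are Casimir functions, so on a level set
   the bracket of two smooth functions depends only on their restrictions. *)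
Lemma poisson_casimir_gamma f x : poisson (fun y => dot y.1 y.1) f x = 0.
Proof.
have EM i : d_M i (fun y => dot y.1 y.1) x = 0 :> R.
  rewrite /d_M (@derive_val _ _ _ _ _ _ _ (is_derive_dot_gamma _ _)) /=.
  by rewrite dot0r mulr0.
have EG i : d_gamma i (fun y => dot y.1 y.1) x = 2 * x.1 i 0 :> R.
  rewrite /d_gamma (@derive_val _ _ _ _ _ _ _ (is_derive_dot_gamma _ _)) /=.
  by rewrite dot_delta.
rewrite /poisson sum_levi_civita !EM !EG.
do 3 move: (d_M _ f x) => ?.
do 3 move: (d_gamma _ f x) => ?.
do 3 move: (x.1 _ 0) => ?.
do 3 move: (x.2 _ 0) => ?.
ring.
Qed.

Lemma poisson_casimir_gammaM f x : poisson (fun y => dot y.1 y.2) f x = 0.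
Proof.
have EM i : d_M i (fun y => dot y.1 y.2) x = x.1 i 0 :> R.
  rewrite /d_M (@derive_val _ _ _ _ _ _ _ (is_derive_dot_gammaM _ _)) /=.
  by rewrite dot0r addr0 dot_delta.
have EG i : d_gamma i (fun y => dot y.1 y.2) x = x.2 i 0 :> R.
  rewrite /d_gamma (@derive_val _ _ _ _ _ _ _ (is_derive_dot_gammaM _ _)) /=.
  by rewrite dot0r add0r dot_delta.
rewrite /poisson sum_levi_civita !EM !EG.
do 3 move: (d_M _ f x) => ?.
do 3 move: (d_gamma _ f x) => ?.
do 3 move: (x.1 _ 0) => ?.
do 3 move: (x.2 _ 0) => ?.
ring.
Qed.
End LiePoisson.

(* Main.v *)
Require Import Defs.
From HB Require Import structures.
From mathcomp Require Import all_boot all_order all_algebra.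
From mathcomp Require Import all_classical all_reals all_analysis.
From mathcomp Require Import ring.

Set Implicit Arguments.
Unset Strict Implicit.
Unset Printing Implicit Defensive.

Import Order.TTheory GRing.Theory Num.Theory.
Import numFieldNormedType.Exports.

Local Open Scope ring_scope.

(* The gradients of H and K are explicit vectors built from A gamma, A M,
   A^v gamma, A^v M and M, and the bracket is a sum of triple products, so the
   statement makes sense for symmetric A and is covariant under rotations.  With
   u = (gamma, A gamma) - tr A, v = (gamma, A^v gamma), P = v (gamma, A M) -
   u (gamma, A^v M) and Q = (M, A M) + u (M, M), the two functions are
   H = alpha Q - v (M, M) and K = P^2 Q.  On the level set, if M <> 0, one rotates
   to the frame gamma = e_1, M = mu e_2: A becomes an arbitrary symmetric
   matrix, the constraints disappear, and P {H, Q} + 2 Q {H, P} = 0 is a rational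
   identity in mu and the six entries of A.  If M = 0, the gradient of H vanishes. *)

(** * Cyclic indices and small determinants *)

Lemma ord3P (i : 'I_3) : [\/ i = 0, i = 1 | i = 2].
Proof.
case: i => -[|[|[|//]]] p;
  by [apply: Or31; apply/val_inj|apply: Or32; apply/val_inj|apply: Or33; apply/val_inj].
Qed.

(** Addition in ['I_3] is modulo 3, which lets cofactors be indexed cyclically without signs. *)
Lemma ord3D : ((0 + 1 = 1 :> 'I_3) * (0 + 2 = 2 :> 'I_3) * (1 + 1 = 2 :> 'I_3)
  * (1 + 2 = 0 :> 'I_3) * (2 + 1 = 0 :> 'I_3) * (2 + 2 = 1 :> 'I_3)).
Proof. by do !split; apply/val_inj. Qed.

Lemma sum3 (V : nmodType) (F : 'I_3 -> V) : \sum_(i < 3) F i = F 0 + F 1 + F 2.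
Proof.
rewrite !big_ord_recl big_ord0 addr0 addrA.
by congr (_ + F _ + F _); apply/val_inj.
Qed.

Lemma sum2 (V : nmodType) (F : 'I_2 -> V) : \sum_(i < 2) F i = F 0 + F 1.
Proof.
rewrite !big_ord_recl big_ord0 addr0.
by congr (_ + F _); apply/val_inj.
Qed.

Lemma det2E (R : comNzRingType) (B : 'M[R]_2) :
  \det B = B 0 0 * B 1 1 - B 0 1 * B 1 0.
Proof.
rewrite (expand_det_row _ 0) sum2 /cofactor !det_mx11 !mxE.
have -> : lift 0 0 = 1 :> 'I_2 by apply/val_inj.
have -> : lift 1 0 = 0 :> 'I_2 by apply/val_inj.
rewrite /= expr0 expr1; ring.
Qed.


Lemma det3E (R : comNzRingType) (B : 'M[R]_3) :
  \det B = B 0 0 * (B 1 1 * B 2 2 - B 1 2 * B 2 1)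
          - B 0 1 * (B 1 0 * B 2 2 - B 1 2 * B 2 0)
          + B 0 2 * (B 1 0 * B 2 1 - B 1 1 * B 2 0).
Proof.
rewrite (expand_det_row _ 0) sum3 /cofactor !det2E !mxE.
have -> : lift 0 0 = 1 :> 'I_3 by apply/val_inj.
have -> : lift 0 1 = 2 :> 'I_3 by apply/val_inj.
have -> : lift 1 0 = 0 :> 'I_3 by apply/val_inj.
have -> : lift 1 1 = 2 :> 'I_3 by apply/val_inj.
have -> : lift 2 0 = 0 :> 'I_3 by apply/val_inj.
have -> : lift 2 1 = 1 :> 'I_3 by apply/val_inj.
rewrite (_ : (-1) ^+ (val (0 : 'I_3) + val (0 : 'I_3)) = 1 :> R) //.
rewrite (_ : (-1) ^+ (val (0 : 'I_3) + val (1 : 'I_3)) = -1 :> R) //.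
rewrite (_ : (-1) ^+ (val (0 : 'I_3) + val (2 : 'I_3)) = 1 :> R); last by rewrite sqrrN expr1n.
ring.
Qed.

(** * Scalar products, triple products and the bracket of two covectors *)

Section Rotation.
Variable R : realType.
Implicit Types (u v w : 'cV[R]_3) (x X Y : 'cV[R]_3 * 'cV[R]_3)
  (f : 'cV[R]_3 * 'cV[R]_3 -> R) (A B C O : 'M[R]_3).

Lemma dot3E u v : dot u v = u 0 0 * v 0 0 + u 1 0 * v 1 0 + u 2 0 * v 2 0.
Proof. exact: sum3. Qed.

Lemma dotC u v : dot u v = dot v u.
Proof. by apply: eq_bigr => i _; rewrite mulrC. Qed.

Lemma dotDl u v w : dot (u + v) w = dot u w + dot v w.
Proof. by rewrite -big_split; apply: eq_bigr => i _; rewrite mxE mulrDl. Qed.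

Lemma dotZl (c : R) u w : dot (c *: u) w = c * dot u w.
Proof. by rewrite mulr_sumr; apply: eq_bigr => i _; rewrite mxE mulrA. Qed.

Lemma dotDr u v w : dot w (u + v) = dot w u + dot w v.
Proof. by rewrite dotC dotDl !(dotC w). Qed.

Lemma dotZr (c : R) u w : dot w (c *: u) = c * dot w u.
Proof. by rewrite dotC dotZl dotC. Qed.

Lemma dot_mxE u v : dot u v = (u^T *m v) 0 0.
Proof. by rewrite mxE; apply: eq_bigr => i _; rewrite mxE. Qed.

Lemma dot_mull B u v : dot (B *m u) v = dot u (B^T *m v).
Proof. by rewrite !dot_mxE trmx_mul mulmxA. Qed.

(** The scalar triple product, that is, the determinant with columns [u], [v], [w]. *)
Definition triple u v w : R :=
  u 0 0 * (v 1 0 * w 2 0 - v 2 0 * w 1 0)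
  + u 1 0 * (v 2 0 * w 0 0 - v 0 0 * w 2 0)
  + u 2 0 * (v 0 0 * w 1 0 - v 1 0 * w 0 0).

Lemma triple_mul O u v w :
  triple (O *m u) (O *m v) (O *m w) = \det O * triple u v w.
Proof. by rewrite det3E /triple !mxE !sum3; ring. Qed.

(** The Lie-Poisson bivector at [x] evaluated on two gradients, each split into its gamma and M
    parts. Triple products make its behaviour under linear maps visible. *)
Definition lie_bracket x X Y : R :=
  triple x.2 X.2 Y.2 + triple x.1 X.2 Y.1 + triple x.1 X.1 Y.2.

Lemma lie_bracketDr x X Y Z :
  lie_bracket x X (Y + Z) = lie_bracket x X Y + lie_bracket x X Z.
Proof. by rewrite /lie_bracket /triple !mxE; ring. Qed.

Lemma lie_bracketZr x X Y c :
  lie_bracket x X (c *: Y) = c * lie_bracket x X Y.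
Proof. by rewrite /lie_bracket /triple !mxE; ring. Qed.

Lemma lie_bracket0l x Y : lie_bracket x 0 Y = 0.
Proof. by rewrite /lie_bracket /triple !mxE; ring. Qed.

Definition rotate O x := (O *m x.1, O *m x.2).

Lemma rotateD O X Y : rotate O (X + Y) = rotate O X + rotate O Y.
Proof. by rewrite /rotate !mulmxDr. Qed.

Lemma rotateZ O c X : rotate O (c *: X) = c *: rotate O X.
Proof. by rewrite /rotate -!scalemxAr. Qed.

Lemma lie_bracket_rotate O x X Y :
  lie_bracket (rotate O x) (rotate O X) (rotate O Y) = \det O * lie_bracket x X Y.
Proof. by rewrite /lie_bracket !triple_mul -!mulrDr. Qed.

(** * Gradients through directional derivatives, and their calculus *)

Definition has_grad f x X :=
  forall v : 'cV[R]_3 * 'cV[R]_3, is_derive x v f (dot X.1 v.1 + dot X.2 v.2).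

(** Basis directions turn the gradients into partial derivatives, and the six nonzero Levi-Civita
    terms assemble into triple products. From here on the bracket is pure algebra. *)
Lemma poisson_lie_bracket f g x X Y :
  has_grad f x X -> has_grad g x Y -> poisson f g x = lie_bracket x X Y.
Proof.
move=> fX gY.
have dG h Z (hZ : has_grad h x Z) i : d_gamma i h x = Z.1 i 0.
  rewrite /d_gamma (@derive_val _ _ _ _ _ _ _ (hZ _)) /=.
  by rewrite dot0r addr0 dot_delta.
have dM h Z (hZ : has_grad h x Z) i : d_M i h x = Z.2 i 0.
  rewrite /d_M (@derive_val _ _ _ _ _ _ _ (hZ _)) /=.
  by rewrite dot0r add0r dot_delta.
rewrite /poisson sum_levi_civita !(dG _ _ fX) !(dG _ _ gY) !(dM _ _ fX) !(dM _ _ gY).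
have -> : lift ord0 (lift ord0 ord0) = 2 :> 'I_3 by apply/val_inj.
have -> : lift ord0 ord0 = 1 :> 'I_3 by apply/val_inj.
rewrite /lie_bracket /triple.
have -> : ord0 = 0 :> 'I_3 by [].
ring.
Qed.

Lemma has_grad_ext f g x X : f =1 g -> has_grad f x X -> has_grad g x X.
Proof. by move=> /funext ->. Qed.

Lemma has_gradD f g x X Y :
  has_grad f x X -> has_grad g x Y -> has_grad (fun y => f y + g y) x (X + Y).
Proof.
move=> fX gY v; apply: is_derive_eq (is_deriveD (fX v) (gY v)) _.
by rewrite !dotDl; ring.
Qed.

Lemma has_gradM f g x X Y :
  has_grad f x X -> has_grad g x Y ->
  has_grad (fun y => f y * g y) x (f x *: Y + g x *: X).
Proof.
move=> fX gY v; apply: is_derive_eq (is_deriveM (fX v) (gY v)) _.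
by rewrite !dotDl !dotZl /GRing.scale /=; ring.
Qed.

Lemma has_grad_cst (c : R) x : has_grad (fun=> c) x 0.
Proof.
move=> v; apply: is_derive_eq (is_derive_cst c x v) _.
by rewrite !(dotC 0) !dot0r addr0.
Qed.

Lemma has_gradZ (c : R) f x X :
  has_grad f x X -> has_grad (fun y => c * f y) x (c *: X).
Proof.
move=> fX; have := has_gradM (has_grad_cst c x) fX.
by rewrite scaler0 addr0.
Qed.

Lemma is_derive_dot (L1 L2 : 'cV[R]_3 * 'cV[R]_3 -> 'cV[R]_3) x
    (v : 'cV[R]_3 * 'cV[R]_3) :
  linear L1 -> linear L2 ->
  is_derive x v (fun y => dot (L1 y) (L2 y)) (dot (L1 v) (L2 x) + dot (L1 x) (L2 v)).
Proof.
move=> lin1 lin2; apply: is_derive_line.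
(* Along the line [h *: v + x] the function is this quadratic polynomial in [h]; its linear
   coefficient is the derivative at 0. *)
pose p := (dot (L1 v) (L2 v)) *: 'X^2
  + (dot (L1 v) (L2 x) + dot (L1 x) (L2 v)) *: 'X + (dot (L1 x) (L2 x))%:P.
rewrite (_ : (fun _ => _) = horner p).
  apply: is_derive_eq; rewrite /p !derivD !derivZ derivXn derivX derivC.
  by rewrite !hornerE.
apply/funext => h; rewrite /p !(hornerD, hornerZ, hornerX, hornerXn, hornerC) lin1 lin2.
by rewrite !dotDl !dotDr !dotZl !dotZr; ring.
Qed.

(** For symmetric [B], the three gradients here belong to (gamma, B gamma), (gamma, B M) and (M, B
    M). *)
Definition grad_gg B x : 'cV[R]_3 * 'cV[R]_3 := (2 *: (B *m x.1), 0).
Definition grad_gM B x : 'cV[R]_3 * 'cV[R]_3 := (B *m x.2, B *m x.1).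
Definition grad_MM B x : 'cV[R]_3 * 'cV[R]_3 := (0, 2 *: (B *m x.2)).


Lemma fst_mul_linear B : linear (fun y : 'cV[R]_3 * 'cV[R]_3 => B *m y.1).
Proof. by move=> c y z; rewrite mulmxDr -scalemxAr. Qed.

Lemma snd_mul_linear B : linear (fun y : 'cV[R]_3 * 'cV[R]_3 => B *m y.2).
Proof. by move=> c y z; rewrite mulmxDr -scalemxAr. Qed.

Lemma dot_mulr_sym B u v : B^T = B -> dot u (B *m v) = dot (B *m u) v.
Proof. by move=> Bsym; rewrite dot_mull Bsym. Qed.

Lemma has_grad_gg B x : B^T = B ->
  has_grad (fun y => dot y.1 (B *m y.1)) x (grad_gg B x).
Proof.
move=> Bsym v; have lin1 : linear (@fst 'cV[R]_3 'cV[R]_3) by [].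
apply: is_derive_eq (is_derive_dot _ _ lin1 (fst_mul_linear B)) _.
by rewrite dotZl (dotC 0) dot0r addr0 (dotC v.1) dot_mulr_sym // mulr_natl.
Qed.

Lemma has_grad_gM B x : B^T = B ->
  has_grad (fun y => dot y.1 (B *m y.2)) x (grad_gM B x).
Proof.
move=> Bsym v; have lin1 : linear (@fst 'cV[R]_3 'cV[R]_3) by [].
apply: is_derive_eq (is_derive_dot _ _ lin1 (snd_mul_linear B)) _.
by rewrite (dotC v.1) (dot_mulr_sym x.1).
Qed.

Lemma has_grad_MM B x : B^T = B ->
  has_grad (fun y => dot y.2 (B *m y.2)) x (grad_MM B x).
Proof.
move=> Bsym v; have lin2 : linear (@snd 'cV[R]_3 'cV[R]_3) by [].
apply: is_derive_eq (is_derive_dot _ _ lin2 (snd_mul_linear B)) _.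
by rewrite dotZl (dotC 0) dot0r add0r (dotC v.2) dot_mulr_sym // mulr_natl.
Qed.

(** * Explicit gradients of H and K *)

Section Gradients.
Variables (A C : 'M[R]_3) (t c : R).

(* t and c stand for the rotation invariants tr A^-1 and tr A. *)
Definition uF x := dot x.1 (A *m x.1) - c.
Definition vF x := dot x.1 (C *m x.1).
Definition alphaF x := t * vF x + 2 * uF x.
(** Differences are written with [-1 *], and (M, M) below as the form of [1%:M], so that the rules
    for sums, products and quadratic forms apply as they stand. *)
Definition PF x := vF x * dot x.1 (A *m x.2) + -1 * (uF x * dot x.1 (C *m x.2)).
Definition QF x := dot x.2 (A *m x.2) + uF x * dot x.2 (1%:M *m x.2).
Definition HF x := alphaF x * QF x + -1 * (vF x * dot x.2 (1%:M *m x.2)).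
Definition KF x := PF x * PF x * QF x.

Definition grad_alpha x := t *: grad_gg C x + 2 *: grad_gg A x.
Definition grad_P x :=
  (vF x *: grad_gM A x + dot x.1 (A *m x.2) *: grad_gg C x)
  + -1 *: (uF x *: grad_gM C x + dot x.1 (C *m x.2) *: grad_gg A x).
Definition grad_Q x :=
  grad_MM A x + (uF x *: grad_MM 1%:M x + dot x.2 (1%:M *m x.2) *: grad_gg A x).
Definition grad_H x :=
  (alphaF x *: grad_Q x + QF x *: grad_alpha x)
  + -1 *: (vF x *: grad_MM 1%:M x + dot x.2 (1%:M *m x.2) *: grad_gg C x).
Definition grad_K x :=
  (PF x * PF x) *: grad_Q x + QF x *: (PF x *: grad_P x + PF x *: grad_P x).

Hypotheses (Asym : A^T = A) (Csym : C^T = C).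

Lemma has_grad_u x : has_grad uF x (grad_gg A x).
Proof.
by rewrite -[grad_gg A x]addr0; apply: has_gradD; [exact: has_grad_gg|exact: has_grad_cst].
Qed.

Lemma has_grad_Q x : has_grad QF x (grad_Q x).
Proof.
apply: has_gradD; first exact: has_grad_MM.
by apply: has_gradM; [exact: has_grad_u|apply: has_grad_MM; rewrite trmx1].
Qed.

Lemma has_grad_P x : has_grad PF x (grad_P x).
Proof.
apply: has_gradD; last apply: has_gradZ; apply: has_gradM.
- exact: has_grad_gg.
- exact: has_grad_gM.
- exact: has_grad_u.
- exact: has_grad_gM.
Qed.

Lemma has_grad_H x : has_grad HF x (grad_H x).
Proof.
apply: has_gradD; last apply: has_gradZ; apply: has_gradM.
- by apply: has_gradD; apply: has_gradZ; [exact: has_grad_gg|exact: has_grad_u].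
- exact: has_grad_Q.
- exact: has_grad_gg.
- by apply: has_grad_MM; rewrite trmx1.
Qed.

Lemma has_grad_K x : has_grad KF x (grad_K x).
Proof.
by do 2?apply: has_gradM; first [exact: has_grad_P|exact: has_grad_Q].
Qed.

End Gradients.

(** * Covariance of the gradients under orthogonal maps *)

Section Equivariance.
Variables (O : 'M[R]_3) (orthO : O^T *m O = 1%:M).
Local Notation conj B := (O *m B *m O^T).

Lemma dot_rotate u v : dot (O *m u) (O *m v) = dot u v.
Proof. by rewrite dot_mull mulmxA orthO mul1mx. Qed.

Lemma conj_mul B u : conj B *m (O *m u) = O *m (B *m u).
Proof. by rewrite -!mulmxA (mulmxA O^T) orthO mul1mx. Qed.

Lemma conj1 : conj 1%:M = 1%:M.
Proof. by rewrite mulmx1; apply: mulmx1C. Qed.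

Lemma grad_gg_rotate B x : grad_gg (conj B) (rotate O x) = rotate O (grad_gg B x).
Proof. by rewrite /grad_gg /rotate /= conj_mul -scalemxAr mulmx0. Qed.

Lemma grad_gM_rotate B x : grad_gM (conj B) (rotate O x) = rotate O (grad_gM B x).
Proof. by rewrite /grad_gM /rotate /= !conj_mul. Qed.

Lemma grad_MM_rotate B x : grad_MM (conj B) (rotate O x) = rotate O (grad_MM B x).
Proof. by rewrite /grad_MM /rotate /= conj_mul -scalemxAr mulmx0. Qed.

Lemma grad_MM1_rotate x : grad_MM 1%:M (rotate O x) = rotate O (grad_MM 1%:M x).
Proof. by rewrite -{1}conj1 grad_MM_rotate. Qed.

Variables (A C : 'M[R]_3) (t c : R).

(** The scalar coefficients are invariant and the elementary gradients rotate with [x], hence so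
    does their combination. *)
Lemma grad_H_rotate x :
  grad_H (conj A) (conj C) t c (rotate O x) = rotate O (grad_H A C t c x).
Proof.
rewrite /grad_H /grad_Q /grad_alpha /alphaF /QF /uF /vF.
rewrite !grad_gg_rotate !grad_MM_rotate !grad_MM1_rotate /= !mul1mx !conj_mul !dot_rotate.
by rewrite !(rotateD, rotateZ).
Qed.

Lemma grad_K_rotate x :
  grad_K (conj A) (conj C) c (rotate O x) = rotate O (grad_K A C c x).
Proof.
rewrite /grad_K /grad_Q /grad_P /PF /QF /uF /vF.
rewrite !grad_gg_rotate !grad_MM_rotate !grad_MM1_rotate !grad_gM_rotate.
rewrite /= !mul1mx !conj_mul !dot_rotate.
by rewrite !(rotateD, rotateZ).
Qed.

End Equivariance.

End Rotation.

(** * The adapted frame: the identity in it, cofactors, and its existence *)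

Lemma frame_involution (R : realType) (B C : 'M[R]_3) (t mu : R) :
  B^T = B -> \det B != 0 -> t * \det B = \tr C -> C^T = C ->
  C 0 0 = B 1 1 * B 2 2 - B 1 2 ^+ 2 -> C 1 1 = B 0 0 * B 2 2 - B 0 2 ^+ 2 ->
  C 2 2 = B 0 0 * B 1 1 - B 0 1 ^+ 2 -> C 0 1 = B 0 2 * B 1 2 - B 0 1 * B 2 2 ->
  C 0 2 = B 0 1 * B 1 2 - B 0 2 * B 1 1 ->
  C 1 2 = B 0 1 * B 0 2 - B 0 0 * B 1 2 ->
  let x := (delta_mx 0 0, mu *: delta_mx 1 0) in
  lie_bracket x (grad_H B C t (\tr B) x) (grad_K B C (\tr B) x) = 0.
Proof.
move=> Bsym D0 tD Csym C00 C11 C22 C01 C02 C12 x.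
have sB i j : B i j = B j i by rewrite -[in LHS]Bsym mxE.
have sC i j : C i j = C j i by rewrite -[in LHS]Csym mxE.
have e (F : 'M[R]_3) : (F *m x.1 = \col_i F i 0) * (F *m x.2 = mu *: \col_i F i 1).
  split; rewrite /x /=; first by apply/matrixP => i j; rewrite (ord1 j) -colE !mxE.
  by rewrite -scalemxAr; congr (_ *: _); apply/matrixP => i j; rewrite (ord1 j) -colE !mxE.
have bracketE X Y : lie_bracket x X Y
    = mu * (X.2 2 0 * Y.2 0 0 - X.2 0 0 * Y.2 2 0)
      + (X.2 1 0 * Y.1 2 0 - X.2 2 0 * Y.1 1 0)
      + (X.1 1 0 * Y.2 2 0 - X.1 2 0 * Y.2 1 0).
  by rewrite /lie_bracket /triple !mxE /=; ring.
have dot1E u : dot x.1 u = u 0 0 by rewrite dot3E !mxE /=; ring.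
have dot2E u : dot x.2 u = mu * u 1 0 by rewrite dot3E !mxE /=; ring.
(* This is the Leibniz rule for K = P^2 Q: it pulls out a factor P and leaves P {H, Q} + 2 Q {H,
   P}. *)
have leibniz (P Q : R) X Y Z :
    lie_bracket x X ((P * P) *: Y + Q *: (P *: Z + P *: Z))
    = P * (P * lie_bracket x X Y + 2 * Q * lie_bracket x X Z).
  by rewrite !(lie_bracketDr, lie_bracketZr); ring.
rewrite /grad_K leibniz.
rewrite /grad_H /grad_P /grad_Q /grad_alpha !bracketE.
(* The scalar coefficients stay folded while the gradient vectors are expanded into entries of [B]
   and [C]. *)
set al := alphaF _ _ _ _ _; set Q := QF _ _ _; set P := PF _ _ _ _.
set u := uF _ _ _; set v := vF _ _.
rewrite !dot1E !dot2E !mul1mx !e /= !mul1mx !e !mxE /=.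
rewrite {}/P {}/Q {}/al /PF /QF /alphaF -/u -/v.
have {u} -> : u = - (B 1 1 + B 2 2) by rewrite /u /uF dot1E e /mxtrace sum3 !mxE; ring.
have {v} -> : v = C 0 0 by rewrite /v /vF dot1E e !mxE.
rewrite !dot1E !dot2E !mul1mx !e !mxE /=.
(* This introduces the only denominator. Symmetry and the cofactor formulas then leave [mu] and six
   free entries of [B]. *)
have -> : t = \tr C / \det B by rewrite -tD mulfK.
move: D0; rewrite det3E /mxtrace !sum3.
rewrite (sB 1 0) (sB 2 0) (sB 2 1) (sC 1 0) (sC 2 0) (sC 2 1) C00 C11 C22 C01 C02 C12.
move: (B 0 0) (B 1 1) (B 2 2) (B 0 1) (B 0 2) (B 1 2) => a b c d e0 f D0.
by field.
Qed.

(** The matrix of these minors times [B] is [(\det B)%:M]. Cyclic indices absorb the cofactor signs,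
    and [i], [j] are swapped as in an adjugate. *)
Lemma cofactor_mx3E (R : realType) (B : 'M[R]_3) (i j : 'I_3) :
  B \in unitmx ->
  cofactor_mx B i j = B (j + 1) (i + 1) * B (j + 2) (i + 2)
                      - B (j + 1) (i + 2) * B (j + 2) (i + 1).
Proof.
move=> Bu.
pose C : 'M[R]_3 := \matrix_(i, j) (B (j + 1) (i + 1) * B (j + 2) (i + 2)
                                    - B (j + 1) (i + 2) * B (j + 2) (i + 1)).
suff CB : C *m B = (\det B)%:M.
  have -> : cofactor_mx B = C by rewrite -[C](mulmxK Bu) CB mul_scalar_mx.
  by rewrite mxE.
apply/matrixP => k l; rewrite det3E !mxE sum3 !mxE.
by case: (ord3P k) => ->; case: (ord3P l) => ->;
  rewrite !ord3D /= ?mulr1n ?mulr0n; ring.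
Qed.

(** The rows of [O] are [u], [v] and their cross product, the last two divided by [mu], the length
    of [v]. *)
Lemma exists_frame (R : realType) (u v : 'cV[R]_3) :
  dot u u = 1 -> dot u v = 0 -> v != 0 ->
  exists O mu, O^T *m O = 1%:M /\
    rotate O (u, v) = (delta_mx 0 0, mu *: delta_mx 1 0).
Proof.
move=> uu uv v0; pose s := dot v v; pose mu := Num.sqrt s.
have s_gt0 : 0 < s.
  rewrite lt_neqAle eq_sym /s /dot sumr_ge0 ?andbT => [|i _]; last by rewrite -expr2 sqr_ge0.
  apply: contraNN v0; rewrite psumr_eq0 => [/allP z|i _]; last by rewrite -expr2 sqr_ge0.
  apply/eqP/matrixP => i j; rewrite (ord1 j) !mxE.
  by have /eqP := z i (mem_index_enum _); rewrite -expr2 => /eqP; rewrite sqrf_eq0 => /eqP.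
have mu2 : mu * mu = s by rewrite -expr2 sqr_sqrtr // ltW.
have mu0 : mu != 0 by rewrite gt_eqF // sqrtr_gt0.
pose w : 'cV[R]_3 := \col_i [:: u 1 0 * v 2 0 - u 2 0 * v 1 0;
  u 2 0 * v 0 0 - u 0 0 * v 2 0; u 0 0 * v 1 0 - u 1 0 * v 0 0]`_i.
have wu : dot w u = 0 by rewrite dot3E !mxE /=; ring.
have wv : dot w v = 0 by rewrite dot3E !mxE /=; ring.
have ww : dot w w = s.
  (* Lagrange's identity for the cross product [w]. *)
  transitivity (dot u u * s - dot u v ^+ 2); last by rewrite uu uv mul1r expr0n subr0.
  by rewrite /s !dot3E !mxE /=; ring.
pose r (i : 'I_3) := if i == 0 then u else mu^-1 *: (if i == 1 then v else w).
pose O : 'M[R]_3 := \matrix_(i, j) r i j 0.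
have OE z i : (O *m z) i 0 = dot (r i) z.
  by rewrite mxE; apply: eq_bigr => k _; rewrite mxE.
exists O, mu; split.
  (* Orthonormal rows give [O *m O^T = 1%:M]; for square matrices the other order follows. *)
  apply: mulmx1C; apply/matrixP => i j.
  have -> : (O *m O^T) i j = dot (r i) (r j).
    by rewrite mxE; apply: eq_bigr => k _; rewrite !mxE.
  rewrite mxE /r; case: (ord3P i) => ->; case: (ord3P j) => -> /=;
    rewrite ?dotZl ?dotZr ?uu ?(dotC v) ?(dotC u w) ?uv ?wu ?wv ?ww -?/s -?mu2 ?mulr0 //; by field.
rewrite /rotate /=; congr (_, _); apply/matrixP => i j; rewrite (ord1 j) OE /r !mxE.
  by case: (ord3P i) => -> /=; rewrite ?dotZl ?uu ?(dotC v) ?uv ?wu ?mulr0.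
by case: (ord3P i) => -> /=; rewrite ?dotZl ?uv ?wv -?/s -?mu2 ?mulr0 ?mulr1 ?mulKf.
Qed.

(** * Transport of the bracket to the adapted frame *)

Theorem proposition5 (R : realType) (a : 'rV[R]_3) (A : 'M[R]_3)
    (defA : A = diag_mx a) (nsA : A \in unitmx)
    (gamma M : 'cV[R]_3) (hgg : dot gamma gamma = 1) (hgM : dot gamma M = 0) :
  poisson (hatH A) (hatK A) (gamma, M) = 0.
Proof.
pose C := cofactor_mx A; pose t := \tr (invmx A); pose c := \tr A.
have Asym : A^T = A by rewrite defA tr_diag_mx.
have Csym : C^T = C by rewrite /C /cofactor_mx linearZ /= trmx_inv Asym.
have gH : has_grad (hatH A) (gamma, M) (grad_H A C t c (gamma, M)).
  apply: has_grad_ext (has_grad_H _ _ Asym Csym _) => y.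
  by rewrite /HF /QF /alphaF /uF /vF /hatH /hat_alpha mul1mx -/C -/t -/c /=; ring.
have gK : has_grad (hatK A) (gamma, M) (grad_K A C c (gamma, M)).
  apply: has_grad_ext (has_grad_K _ Asym Csym _) => y.
  by rewrite /KF /PF /QF /uF /vF /hatK mul1mx -/C -/c /=; ring.
rewrite (poisson_lie_bracket gH gK).
(* At M = 0 there is no second axis, but each term of [grad_H] contains Q, (M, M) or a [grad_MM],
   all zero there. *)
have [->|M0] := eqVneq M 0.
  have MM0 B : grad_MM B (gamma, 0) = 0 by rewrite /grad_MM /= mulmx0 scaler0.
  have -> : grad_H A C t c (gamma, 0) = 0.
    rewrite /grad_H /grad_Q /QF !MM0 /= !mulmx0 !dot0r.
    by rewrite !(mulr0, scaler0, scale0r, addr0).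
  exact: lie_bracket0l.
have [U [mu [orthU frameE]]] := exists_frame hgg hgM M0.
have detU : \det U * \det U = 1 by rewrite -{1}det_tr -det_mulmx orthU det1.
have detU0 : \det U != 0.
  by apply: contra_eq_neq detU => ->; rewrite mul0r eq_sym oner_eq0.
(* Rotating all arguments multiplies the bracket by [\det U], so vanishing can be checked after
   rotation. *)
apply: (mulfI detU0).
rewrite mulr0 -lie_bracket_rotate -grad_H_rotate // -grad_K_rotate // frameE.
pose B := U *m A *m U^T; rewrite -/B.
have Bsym : B^T = B by rewrite /B !trmx_mul trmxK Asym mulmxA.
have detB : \det B = \det A by rewrite /B !det_mulmx det_tr mulrAC detU mul1r.
have Bu : B \in unitmx by rewrite unitmxE detB -unitmxE.
have trconj D : \tr (U *m D *m U^T) = \tr D by rewrite mxtrace_mulC mulmxA orthU mul1mx.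
(* Conjugation by [U] preserves the determinant and commutes with inversion, hence with taking
   cofactors. *)
have CE : U *m C *m U^T = cofactor_mx B.
  rewrite /C /cofactor_mx detB -scalemxAr -scalemxAl; congr (_ *: _).
  rewrite -[LHS](mulmxK Bu) -[RHS]mul1mx; congr (_ *m _).
  by rewrite /B -!mulmxA (mulmxA U^T U) orthU mul1mx (mulmxA (invmx A)) mulVmx // mul1mx mulmx1C.
rewrite CE; have -> : c = \tr B by rewrite trconj.
have sB i j : B i j = B j i by rewrite -[in LHS]Bsym mxE.
apply: frame_involution => //.
- by rewrite detB -unitfE -unitmxE.
- by rewrite -CE trconj mxtraceZ detB mulrC.
- by rewrite /cofactor_mx linearZ /= trmx_inv Bsym.
(* What remains are the six entries of the cofactor matrix of the symmetric [B]. *)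
all: rewrite cofactor_mx3E // !ord3D.
all: rewrite ?(sB 1 0) ?(sB 2 0) ?(sB 2 1); ring.
Qed.
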